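(* Let $k$ be even. For each colored graph $(\Gamma;\vec{j'})$ there exists a unique external edge class in $H^1(\Gamma;\vec{j'})$; that is, there is a twisted 1-cocycle $\delta=(\delta_{\vec j}):H_1(\Gamma)\to A(\Gamma;\vec{j'})$ such that $$\delta_{\vec j}(\lambda)=(-1)^{\sum_{f_l\in \mathrm{Ex}(\lambda)}j_l}\quad\text{for all }\lambda\in H_1(\Gamma)\text{ and }\vec j\in QCG_k(\Gamma;\vec{j'})\text{ with }\lambda\cdot\vec j=\vec j,$$ and any two twisted 1-cocycles with this property have the same cohomology class in $H^1(\Gamma;\vec{j'})$.
   Context: Fix an even positive integer $k$ (the level) and a commutative ring $R$ with unit; $R^\times$ is its group of units. A unitrivalent graph is a finite graph (loops and multiple edges allowed) all of whose vertices are trivalent or univalent. Let $\Gamma$ be a unitrivalent graph with $3g-3+2n$ edges $\{f_l\}$, $2g-2+n$ trivalent vertices and $n$ univalent vertices $w_1,\dots,w_n$, the edges being numbered so that $f_1,\dots,f_n$ are the edges incident to $w_1,\dots,w_n$. $H_1(\Gamma)$ denotes homology with $\mathbb Z/2$ coefficients, $H_1(\Gamma)\cong(\mathbb Z/2)^g$; an element $\lambda\in H_1(\Gamma)$ is a mod 2 cycle, identified with the set of edges lying on it. A colored graph is a pair $(\Gamma;\vec{j'})$ with $\vec{j'}=(j'_1,\dots,j'_n)\in\{0,\frac12,\dots,\frac k2\}^n$. $QCG_k(\Gamma;\vec{j'})$ is the set of admissible colorings of level $k$: maps $\vec j=(j_l):\{f_l\}\to\{0,\frac12,\dots,\frac k2\}$,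 $j_l:=\vec j(f_l)$, with $j_l=j'_l$ for $l=1,\dots,n$, such that at each trivalent vertex with incident edges $f_{i_1},f_{i_2},f_{i_3}$ one has $j_{i_1}+j_{i_2}+j_{i_3}\in\mathbb Z$, $|j_{i_1}-j_{i_2}|\le j_{i_3}\le j_{i_1}+j_{i_2}$ and $j_{i_1}+j_{i_2}+j_{i_3}\le k$ (for a vertex with a loop, $f_{i_2}=f_{i_3}$ and the conditions are read with $j_{i_2}=j_{i_3}$). $H_1(\Gamma)$ acts on $QCG_k(\Gamma;\vec{j'})$: $\lambda\cdot\vec j$ is obtained from $\vec j$ by replacing $j_l$ with $\frac k2-j_l$ for every edge $f_l$ lying on $\lambda$, and leaving the other entries unchanged. Put $A(\Gamma;\vec{j'}):=(R^\times)^{QCG_k(\Gamma;\vec{j'})}$, with $H_1(\Gamma)$-action $\lambda:(c_{\vec j})\mapsto(c_{\lambda\cdot\vec j})$. $H^*(\Gamma;\vec{j'})$ is the group cohomology $H^*(H_1(\Gamma);A(\Gamma;\vec{j'}))$ (coefficients written multiplicatively). Explicitly, a twisted 1-cocycle is a map $\delta=(\delta_{\vec j}):H_1(\Gamma)\to A(\Gamma;\vec{j'})$ with $\delta_{\vec j}(\lambda+\lambda')=\delta_{\lambda\cdot\vec j}(\lambda')\,\delta_{\vec j}(\lambda)$, and a coboundary is one of the form $\delta_{\vec j}(\lambda)=c_{\lambda\cdot\vec j}\,c_{\vec j}^{-1}$ for some $(c_{\vec j})\in A(\Gamma;\vec{j'})$. For $\lambda\in H_1(\Gamma)$, an edge $f_l$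 is $\lambda$-external if $\lambda$ does not pass through $f_l$ and exactly one of the two end vertices of $f_l$ lies on $\lambda$ (i.e. is an endpoint of an edge on $\lambda$). $\mathrm{Ex}(\lambda)$ is the set of $\lambda$-external edges. (If $\lambda\cdot\vec j=\vec j$ then $j_l$ is an integer for all $f_l\in\mathrm{Ex}(\lambda)$, so the sign makes sense.) A twisted 1-cocycle satisfying the displayed condition is said to satisfy the external edge condition and is called an external edge cocycle; its cohomology class is called an external edge class. *)

(* Defs.v *)
From HB Require Import structures.
From mathcomp Require Import all_boot all_order all_algebra.
From mathcomp Require Import ring lra zify.

Set Implicit Arguments.
Unset Strict Implicit.
Unset Printing Implicit Defensive.

Import Order.TTheory GRing.Theory Num.Theory.
Local Open Scope ring_scope.

(* The group R^* of a commutative ring, as pairs (u, u^-1). The second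
   component is determined by the first one, and the trivial ring is allowed. *)
Section Units.
Variable R : comPzRingType.

Record units := Units { unit_pair : R * R; _ : unit_pair.1 * unit_pair.2 == 1 }.
HB.instance Definition _ := [isSub for unit_pair].
HB.instance Definition _ := [Choice of units by <:].

Definition ring_of_unit (u : units) : R := (val u).1.

Lemma ring_of_unit_inj : injective ring_of_unit.
Proof.
move=> [[x y] /= xy] [[x' y'] /= xy']; rewrite /ring_of_unit /= => exx'.
apply: val_inj => /=; subst x'; congr (_, _); move/eqP: xy; move/eqP: xy'.
by move=> xy' xy; rewrite -[y]mulr1 -xy' mulrA [y * x]mulrC xy mul1r.
Qed.

Lemma unit_one_subproof : (1 : R) * 1 == 1. Proof. by rewrite mulr1. Qed.
Definition unit_one : units := Sub (1, 1) unit_one_subproof.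

Lemma unit_inv_subproof (u : units) : (val u).2 * (val u).1 == 1.
Proof. by rewrite mulrC (valP u). Qed.
Definition unit_inv (u : units) : units :=
  Sub ((val u).2, (val u).1) (unit_inv_subproof u).

Lemma unit_mul_subproof (u v : units) :
  ((val u).1 * (val v).1) * ((val u).2 * (val v).2) == 1.
Proof. by rewrite mulrACA (eqP (valP u)) (eqP (valP v)) mulr1. Qed.
Definition unit_mul (u v : units) : units :=
  Sub ((val u).1 * (val v).1, (val u).2 * (val v).2) (unit_mul_subproof u v).

Lemma unit_mulA : associative unit_mul.
Proof. by move=> u v w; apply: ring_of_unit_inj; apply: mulrA. Qed.
Lemma unit_mul1g : left_id unit_one unit_mul.
Proof. by move=> u; apply: ring_of_unit_inj; apply: mul1r. Qed.
Lemma unit_mulg1 : right_id unit_one unit_mul.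
Proof. by move=> u; apply: ring_of_unit_inj; apply: mulr1. Qed.
Lemma unit_mulVg : left_inverse unit_one unit_inv unit_mul.
Proof.
by move=> u; apply: ring_of_unit_inj; apply/eqP; apply: unit_inv_subproof.
Qed.
Lemma unit_mulgV : right_inverse unit_one unit_inv unit_mul.
Proof. by move=> u; apply: ring_of_unit_inj; apply/eqP; apply: (valP u). Qed.

HB.instance Definition _ := isGroup.Build units
  unit_mulA unit_mul1g unit_mulg1 unit_mulVg unit_mulgV.

End Units.

(* The two ends of an edge e are the half-edges (e, false) and (e, true), and
   node h is the vertex to which the half-edge h is attached; a loop is an
   edge whose two ends are attached to the same vertex, and counts twice in the
   valence. The univalent vertices are univ 0, ..., univ (n-1), and leg i is
   the edge incident to univ i. *)
Record unitrivalent_graph (g n : nat) := UnitrivalentGraph {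
  vertex : finType;
  edge : finType;
  node : edge * bool -> vertex;
  univ : 'I_n -> vertex;
  leg : 'I_n -> edge;
  univ_inj : injective univ;
  leg_inj : injective leg;
  leg_univ : forall i, exists b, node (leg i, b) = univ i;
  valenceE : forall v : vertex,
    #|[set h | node h == v]| = (if v \in codom univ then 1 else 3)%N;
  card_edge : #|edge|%:Z = 3 * g%:Z - 3 + 2 * n%:Z;
  card_trivalent : #|[predC codom univ]|%:Z = 2 * g%:Z - 2 + n%:Z
}.

Section Graph.
Variables (g n : nat) (G : unitrivalent_graph g n).
Implicit Types (c : {ffun edge G -> 'F_2}) (v : vertex G) (e : edge G).

(* C_1 = {ffun edge G -> 'F_2}, C_0 = {ffun vertex G -> 'F_2}, and there are no
   2-chains, so that H_1 is the kernel of the boundary. *)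
Definition boundary c : {ffun vertex G -> 'F_2} :=
  [ffun v => \sum_(h | node h == v) c h.1].

Definition is_cycle c := boundary c == 0.

Lemma is_cycle_closed : zmod_closed is_cycle.
Proof.
rewrite /is_cycle; split=> [|c d]; rewrite !unfold_in /=.
  by apply/eqP/ffunP => v; rewrite !ffunE big1 // => h _; rewrite ffunE.
move=> /eqP/ffunP c0 /eqP/ffunP d0; apply/eqP/ffunP => v; rewrite !ffunE.
move: (c0 v) (d0 v); rewrite !ffunE => cv dv.
under eq_bigr => h _ do rewrite !ffunE.
by rewrite sumrB cv dv subr0.
Qed.

Record H1 := Cycle { chain : {ffun edge G -> 'F_2}; _ : is_cycle chain }.
HB.instance Definition _ := [isSub for chain].
HB.instance Definition _ := [Choice of H1 by <:].
HB.instance Definition _ :=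
  GRing.SubChoice_isSubZmodule.Build _ is_cycle H1 is_cycle_closed.

Definition edges_of (l : H1) : {set edge G} := [set e | val l e != 0].

Definition lies_on (l : H1) v := [exists h, (node h == v) && (h.1 \in edges_of l)].

Definition external (l : H1) : {set edge G} :=
  [set e | (e \notin edges_of l)
           && (lies_on l (node (e, false)) (+) lies_on l (node (e, true)))].

End Graph.

(* The color a / 2 is represented by a : 'I_k.+1. *)
Definition half (k : nat) (a : 'I_k.+1) : rat := (nat_of_ord a)%:R / 2.

(* a |-> k - a on 'I_k.+1 *)
Definition flip (k : nat) (a : 'I_k.+1) : 'I_k.+1 := rev_ord a.

Lemma half_flip k (a : 'I_k.+1) : half (flip a) = k%:R / 2 - half a.
Proof. by rewrite /half /= subSS natrB -1?ltnS //; field. Qed.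

Definition admissible_triple (k : nat) (a b c : 'I_k.+1) : bool :=
  [&& half a + half b + half c \is a Num.int,
      `|half a - half b| <= half c,
      half c <= half a + half b
    & half a + half b + half c <= k%:R].

Lemma admissible_triple_flip k (a b c : 'I_k.+1) :
  admissible_triple a b c -> admissible_triple (flip a) (flip b) c.
Proof.
rewrite /admissible_triple !half_flip => /and4P[intS].
rewrite !ler_norml => /andP[h1 h2] h3 h4; apply/and4P; split; [|lra..].
suff -> : k%:R / 2 - half a + (k%:R / 2 - half b) + half c
   = (half a + half b + half c) + k%:R - (val a)%:R - (val b)%:R :> rat.
  by rewrite rpredB ?natr_int // rpredB ?natr_int // rpredD ?natr_int.
by rewrite /half; field.
Qed.

Lemma admissible_tripleC12 k (a b c : 'I_k.+1) :
  admissible_triple a b c = admissible_triple b a c.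
Proof. by rewrite /admissible_triple distrC ![half a + half b]addrC. Qed.

Lemma admissible_tripleC23 k (a b c : 'I_k.+1) :
  admissible_triple a b c = admissible_triple a c b.
Proof.
rewrite /admissible_triple addrAC; congr andb; rewrite !ler_norml.
by apply/and3P/and3P => -[/andP[? ?] ? ?]; split; try (apply/andP; split); lra.
Qed.

Section Colorings.
Variables (k g n : nat) (G : unitrivalent_graph g n).
Variable j' : {ffun 'I_n -> 'I_k.+1}.
Implicit Types (j : {ffun edge G -> 'I_k.+1}) (l : H1 G).

Definition admissible j : bool :=
  [forall h1 : edge G * bool, forall h2 : edge G * bool,
   forall h3 : edge G * bool,
     [&& uniq [:: h1; h2; h3], node h1 == node h2 & node h2 == node h3]
       ==> admissible_triple (j h1.1) (j h2.1) (j h3.1)].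

Definition is_QCG j : bool :=
  admissible j && [forall i, j (leg G i) == j' i].

Record QCG := Coloring { coloring : {ffun edge G -> 'I_k.+1}; _ : is_QCG coloring }.
HB.instance Definition _ := [isSub for coloring].
HB.instance Definition _ := [Finite of QCG by <:].

Definition flip_on l j : {ffun edge G -> 'I_k.+1} :=
  [ffun e => if e \in edges_of l then flip (j e) else j e].

Lemma edges_of_trivalent l (h1 h2 h3 : edge G * bool) :
  uniq [:: h1; h2; h3] -> node h1 = node h2 -> node h2 = node h3 ->
  (h1.1 \in edges_of l) (+) (h2.1 \in edges_of l) = (h3.1 \in edges_of l).
Proof.
move=> u e12 e23.
have eqV : [set h | node h == node h3] = [set h in [:: h1; h2; h3]].
  apply/esym/eqP; rewrite eqEcard; apply/andP; split.
    apply/subsetP => h; rewrite !inE.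
    by case/or3P => /eqP ->; rewrite ?e12 ?e23.
  rewrite valenceE cardsE (card_uniqP u) /=.
  by case: ifP.
have /eqP/ffunP/(_ (node h3)) := valP l; rewrite !ffunE /=.
rewrite (eq_bigl (mem [:: h1; h2; h3])); last first.
  by move=> h; have := congr1 (fun A : {set _} => h \in A) eqV; rewrite !inE.
rewrite -big_uniq //= !big_cons big_nil addr0 !inE /=.
move: (chain l h1.1) (chain l h2.1) (chain l h3.1).
by move=> [[|[|a]] // ?] [[|[|b]] // ?] [[|[|c]] // ?].
Qed.

Lemma leg_notin_edges_of l i : leg G i \notin edges_of l.
Proof.
have [b eb] := leg_univ G i.
have /eqP/ffunP/(_ (univ G i)) := valP l; rewrite !ffunE /=.
have := valenceE (univ G i); rewrite codom_f => /eqP/cards1P[h eqh].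
have hE : (leg G i, b) = h by apply/eqP; rewrite -in_set1 -eqh inE eb.
rewrite (eq_bigl (pred1 h)); last first.
  by move=> x; have := congr1 (fun A : {set _} => x \in A) eqh; rewrite !inE.
by rewrite big_pred1_eq inE -hE /= => ->; rewrite eqxx.
Qed.

Lemma flip_on_QCG l (j : QCG) : is_QCG (flip_on l (val j)).
Proof.
have /andP[/forallP adm /forallP bd] := valP j; apply/andP; split; last first.
  by apply/forallP => i; rewrite ffunE (negbTE (leg_notin_edges_of l i)) bd.
apply/forallP => h1; apply/forallP => h2; apply/forallP => h3.
apply/implyP => hh; have /forallP/(_ h2)/forallP/(_ h3) := adm h1.
move/implyP/(_ hh); case/and3P: hh => u /eqP e12 /eqP e23 A.
rewrite !ffunE -(edges_of_trivalent l u e12 e23).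
move: A; case: (h1.1 \in _); case: (h2.1 \in _) => //=.
- exact: admissible_triple_flip.
- rewrite admissible_tripleC23 => /admissible_triple_flip.
  by rewrite admissible_tripleC23.
- rewrite admissible_tripleC12 admissible_tripleC23.
  move/admissible_triple_flip.
  by rewrite admissible_tripleC23 admissible_tripleC12.
Qed.

Definition act l (j : QCG) : QCG := Coloring (flip_on_QCG l j).

Lemma act0 (j : QCG) : act 0 j = j.
Proof. by apply/val_inj/ffunP => e; rewrite ffunE inE ffunE. Qed.

Lemma actD l l' (j : QCG) : act (l + l') j = act l (act l' j).
Proof.
apply/val_inj/ffunP => e; rewrite !ffunE !inE !ffunE /flip.
case: (chain l e) (chain l' e) => [[|[|a]] // ?] [[|[|b]] // ?] //=.
by rewrite rev_ordK.
Qed.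

End Colorings.

Arguments QCG {k g n} G j'.

Section Cohomology.
Variables (k : nat) (R : comPzRingType) (g n : nat).
Variables (G : unitrivalent_graph g n) (j' : {ffun 'I_n -> 'I_k.+1}).

(* The library's pointwise group structure on finite functions is used on
   these coefficients. *)
Definition coefficients := {ffun QCG G j' -> units R}.

Local Open Scope group_scope.

Definition coef_act (l : H1 G) (c : coefficients) : coefficients :=
  [ffun j => c (act l j)].

Definition cochain1 := H1 G -> coefficients.

Definition is_cocycle (d : cochain1) : Prop :=
  forall (l l' : H1 G) (j : QCG G j'), d (l + l')%R j = d l' (act l j) * d l j.

Definition is_coboundary (d : cochain1) : Prop :=
  exists c : coefficients,
    forall (l : H1 G) (j : QCG G j'), d l j = coef_act l c j * (c j)^-1.

(* Equality of classes in H^1. *)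
Definition cohomologous (d d' : cochain1) : Prop :=
  is_coboundary (fun l => d l * (d' l)^-1).

(* For k even and l . j = j, the sum is a nonnegative integer, on which truncn is the
   identity. *)
Definition external_edge_condition (d : cochain1) : Prop :=
  forall (l : H1 G) (j : QCG G j'), act l j = j ->
    ring_of_unit (d l j) =
      ((-1) ^+ Num.truncn (\sum_(e in external l) half (coloring j e)))%R.

Definition external_edge_cocycle (d : cochain1) : Prop :=
  is_cocycle d /\ external_edge_condition d.

End Cohomology.

Arguments cochain1 {k} R {g n} G j'.

(* Main.v *)
Require Import Defs.
From mathcomp Require Import all_boot all_order all_algebra.
From HB Require Import structures.
From mathcomp Require Import ring zify.

Set Implicit Arguments.
Unset Strict Implicit.
Unset Printing Implicit Defensive.

Import GRing.Theory Num.Theory.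

(** By Shapiro's lemma, the first cohomology of an abelian group acting on a set
    X, with values in the functions from X to an abelian group with trivial
    action, is a product over the orbits of the groups of characters of the
    stabilisers, the class of d being detected by the restrictions of the
    d l x to the l fixing x. Two external edge cocycles have the same
    restrictions, hence the same class
    ([coboundary_of_trivial_on_stabilisers]); for the existence
    ([cocycle_of_characters]), the sign of the external edge sum must be a
    character of each stabiliser that does not change along orbits.

    Write a e = 2 (j e), a natural number. If l fixes j, then a e = k / 2 for
    each e on l, and the external edge sum is congruent mod 2 to the sum, over
    the trivalent vertices v on l, of half of a on the third edge at v (an edge
    that leaves l and comes back is counted twice, with an integral weight).
    Mod 2 this third color is half of the sum of a over the three edges at v,
    plus k / 2, a weight that does not involve l any more.

    For two cycles l and m, let crossing l m v be the number of half-edges at v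
    lying on both. Mod 2 it is 1 exactly when l and m pass through v along
    different pairs of half-edges, and its sum over all v is even since each
    edge has two halves. Mod 2, it is the defect of additivity of the indicator
    that a cycle passes through v. So for l and m fixing j the defect of
    additivity of the external edge sum is the sum of crossing l m v times the
    weight of v; but where they cross the three edges have a = k / 2, so that
    the weight is k / 4 mod 2 everywhere, and the defect is even
    ([odd_cycle_weightD]).
    Likewise, the action of m on j changes the weight of a vertex on l by
    k / 2 times crossing l m v, which again sums to an even number
    ([odd_cycle_weight_act]). *)

(** * Cocycles of an abelian group acting on a set *)

Section TwistedCocycles.
Variables (V : finZmodType) (X : choiceType) (A : groupType).
Variable act : V -> X -> X.
Hypothesis act0 : forall x, act 0%R x = x.
Hypothesis actD : forall l m x, act (l + m)%R x = act l (act m x).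

Definition twisted_cocycle (d : V -> X -> A) :=
  forall l m x, d (l + m)%R x = (d m (act l x) * d l x)%g.

(** A representative of each orbit, and for each point a group element that
    carries the representative to it: the choices behind Shapiro's lemma. *)
Lemma orbit_section :
  exists (rep : X -> X) (t : X -> V),
    (forall x, act (t x) (rep x) = x) /\ (forall l x, rep (act l x) = rep x).
Proof.
pose orb x y := [exists l, act l y == x].
have orbM l x y : orb (act l x) y = orb x y.
  apply/existsP/existsP => -[m mE].
    by exists (- l + m)%R; rewrite actD (eqP mE) -actD addNr act0.
  by exists (l + m)%R; rewrite actD (eqP mE).
have orbxx x : orb x x by apply/existsP; exists 0%R; rewrite act0.
pose rep x := choose (orb x) x.
have repP x : orb x (rep x) by apply: chooseP.
have tP x : exists l, act l (rep x) == x by apply/existsP; apply: repP.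
exists rep, (fun x => xchoose (tP x)); split=> [x|l x].
  by apply/eqP; apply: (xchooseP (tP x)).
rewrite /rep (eq_choose (orbM l x)); apply: choose_id => //.
by apply/existsP; exists (- l)%R; rewrite -actD addNr act0.
Qed.

(** Shapiro's lemma, surjectivity: the element [l + t x - t (act l x)] fixes
    the representative of the orbit of [x]; these elements satisfy the cocycle
    identity in the group, and composing with the character of the stabiliser
    of the representative keeps it. *)
Lemma cocycle_of_characters (chi : V -> X -> A) :
  (forall l m x, act l x = x -> act m x = x ->
     chi (l + m)%R x = (chi m x * chi l x)%g) ->
  (forall l m x, act l x = x -> chi l (act m x) = chi l x) ->
  exists d, twisted_cocycle d /\ forall l x, act l x = x -> d l x = chi l x.
Proof.
move=> chiD chi_act; have [rep [t [tK repM]]] := orbit_section.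
have actK m x : act (- m)%R (act m x) = x by rewrite -actD addNr act0.
have stab l x : act (l + t x - t (act l x))%R (rep x) = rep x.
  rewrite addrC !actD tK -[in RHS](actK (t (act l x)) (rep x)).
  by congr (act _ _); rewrite -(repM l x) tK.
exists (fun l x => chi (l + t x - t (act l x))%R (rep x)).
split=> [l m x|l x lx].
  have := stab m (act l x); rewrite repM => stab_m.
  rewrite -chiD ?stab // -actD [(m + l)%R]addrC; congr (chi _ _).
  rewrite [RHS]addrA [(m + t _)%R]addrC [X in (X - _)%R = _]addrC.
  rewrite [in RHS]addrA subrK.
  by congr (_ - _)%R; rewrite addrA [(t x + l)%R]addrC.
have := stab l x; rewrite lx addrK => l_rep.
by rewrite -[in RHS](tK x) chi_act.
Qed.

(** Shapiro's lemma, injectivity: along an orbit, the value of [d] on an element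
    that carries the representative to [x] only depends on [x], and gives the
    function whose coboundary is [d]. *)
Lemma coboundary_of_trivial_on_stabilisers (d : V -> X -> A) :
  twisted_cocycle d ->
  (forall l x, act l x = x -> d l x = 1%g) ->
  exists c : X -> A, forall l x, d l x = (c (act l x) * (c x)^-1)%g.
Proof.
move=> dD d1; have [rep [t [tK repM]]] := orbit_section.
have actK m x : act (- m)%R (act m x) = x by rewrite -actD addNr act0.
exists (fun x => d (t x) (rep x)) => l x; rewrite repM.
have -> : d (t (act l x)) (rep x) = d (t x + l)%R (rep x).
  pose s := (t (act l x) - (t x + l))%R.
  have sx : act s (rep x) = rep x.
    have lE : act (t (act l x)) (rep x) = act (t x + l)%R (rep x).
      by rewrite -[in LHS](repM l x) tK addrC actD tK.
    by rewrite /s addrC actD lE actK.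
  have -> : t (act l x) = (s + (t x + l))%R by rewrite /s subrK.
  by rewrite dD sx (d1 s) // mulg1.
by rewrite dD tK mulgK.
Qed.

End TwistedCocycles.

(** * Cycles at a trivalent vertex *)

Local Notation halfedge G := (edge G * bool)%type.

HB.instance Definition _ (g n : nat) (G : unitrivalent_graph g n) :=
  [Countable of H1 G by <:].
HB.instance Definition _ (g n : nat) (G : unitrivalent_graph g n) :=
  [Finite of H1 G by <:].

Lemma odd_sum (I : finType) (F : I -> nat) :
  odd (\sum_i F i) = \big[addb/false]_i odd (F i).
Proof. exact: (big_morph odd oddD). Qed.

Section Graph.
Variables (g n : nat) (G : unitrivalent_graph g n).
Implicit Types (l m : H1 G) (v : vertex G).

Lemma mem_edgesD l m e :
  (e \in edges_of (l + m)%R) = (e \in edges_of l) (+) (e \in edges_of m).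
Proof.
rewrite !inE ffunE.
by case: (chain l e) (chain m e) => [[|[|a]] // ?] [[|[|b]] // ?].
Qed.

(** Sums and existence over the half-edges at a trivalent vertex are made
    explicit, so that the local parity statements reduce to a case analysis on
    which of the three edges lie on the cycles. *)
Variant vertex_spec v : Prop :=
| EndVertex of forall l, ~~ lies_on l v
| TrivalentVertex (h1 h2 h3 : halfedge G) of
    uniq [:: h1; h2; h3] & node h1 = node h2 & node h2 = node h3
  & forall h, (node h == v) = (h \in [:: h1; h2; h3])
  & forall F : halfedge G -> nat,
      \sum_(h | node h == v) F h = F h1 + F h2 + F h3
  & forall l, lies_on l v =
      [|| h1.1 \in edges_of l, h2.1 \in edges_of l | h3.1 \in edges_of l].

Lemma vertexP v : vertex_spec v.
Proof.
have := valenceE v; case: ifP => [/codomP[i ->] /eqP/cards1P[h hE]|_ v3].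
  left=> l; apply/existsP => -[h' /andP[h'v]].
  have [b legE] := leg_univ G i.
  have /set1P -> : h' \in [set h] by rewrite -hE inE.
  have /set1P <- : (leg G i, b) \in [set h] by rewrite -hE inE legE.
  exact/negP/leg_notin_edges_of.
have := cardE [set h | node h == v]; rewrite v3.
have := enum_uniq [set h | node h == v].
have memE h : (h \in enum [set h | node h == v]) = (node h == v).
  by rewrite mem_enum inE.
case: (enum _) memE => [//|h1 [//|h2 [//|h3 [|//]]]] memE uE _.
have nodeE h : h \in [:: h1; h2; h3] -> node h = v by rewrite memE => /eqP.
apply: (TrivalentVertex (h1 := h1) (h2 := h2) (h3 := h3)) => [|||h|F|l].
- exact: uE.
- by rewrite !nodeE ?inE ?eqxx ?orbT.
- by rewrite !nodeE ?inE ?eqxx ?orbT.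
- by rewrite -memE.
- rewrite (eq_bigl (mem [:: h1; h2; h3])) => [|h]; last by rewrite -memE.
  by rewrite -big_uniq //= !big_cons big_nil addn0 addnA.
- transitivity (has (fun h => h.1 \in edges_of l) [:: h1; h2; h3]).
    apply/existsP/hasP => [[h /andP[hv hl]]|[h hE hl]]; exists h => //.
      by rewrite memE.
    by rewrite -memE hE.
  by rewrite /= orbF.
Qed.

(** Mod 2, this is the local term of the bilinear form polarising the quadratic
    form that maps a cycle to the indicator of its passing through [v]. *)
Definition crossing l m v : nat :=
  \sum_(h : halfedge G | node h == v)
     ((h.1 \in edges_of l) && (h.1 \in edges_of m)).

Lemma sum_halfedges (F : halfedge G -> nat) :
  \sum_v \sum_(h | node h == v) F h = \sum_e (F (e, false) + F (e, true)).
Proof.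
rewrite (exchange_big_dep xpredT) //=.
under eq_bigr => h _ do rewrite (big_pred1 (node h)) //.
rewrite (eq_bigr (fun h => F (h.1, h.2))) => [|[] //].
rewrite -(pair_bigA _ (fun e b => F (e, b))) /=.
by under eq_bigr => e _ do rewrite big_bool /= addnC.
Qed.

(** The two halves of an edge contribute equally. *)
Lemma even_crossings l m : ~~ odd (\sum_v crossing l m v).
Proof.
rewrite sum_halfedges odd_sum big1 // => e _ /=.
by rewrite addnn odd_double.
Qed.

Lemma crossing0 l m v : ~~ lies_on l v -> crossing l m v = 0.
Proof.
move=> /existsPn lv; apply: big1 => h hv.
by have := lv h; rewrite hv /= => /negbTE ->.
Qed.

End Graph.

(** * Parity of the external edge sum *)

Section Colorings.
Variables (k g n : nat) (G : unitrivalent_graph g n).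
Variable j' : {ffun 'I_n -> 'I_k.+1}.
Implicit Types (j : QCG G j') (l m : H1 G) (v : vertex G).

Lemma admissible_triple_even (a b c : 'I_k.+1) :
  admissible_triple a b c -> ~~ odd (a + b + c).
Proof.
case/and4P=> /intrP[z zE] _ _ _.
have: ((a + b + c)%N%:Z%:~R = (2 * z)%R%:~R :> rat)%R.
  by rewrite intrM -zE -pmulrn !natrD /Defs.half; field.
by move/intr_inj; lia.
Qed.

Lemma even_at_trivalent j (h1 h2 h3 : halfedge G) :
  uniq [:: h1; h2; h3] -> node h1 = node h2 -> node h2 = node h3 ->
  ~~ odd (coloring j h1.1 + coloring j h2.1 + coloring j h3.1).
Proof.
move=> u e12 e23; apply: admissible_triple_even.
have /andP[/forallP/(_ h1)/forallP/(_ h2)/forallP/(_ h3)/implyP H _] := valP j.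
by apply: H; rewrite u e12 e23 !eqxx.
Qed.

Lemma act_color l j e :
  coloring (act l j) e
    = (if e \in edges_of l then k - coloring j e else coloring j e) :> nat.
Proof. by rewrite ffunE; case: ifP; rewrite // /flip /= subSS. Qed.

Lemma color_fixed l j e :
  act l j = j -> e \in edges_of l -> (coloring j e).*2 = k.
Proof.
move=> lj el; have := act_color l j e; rewrite lj el.
by have := ltn_ord (coloring j e); lia.
Qed.

(** If [v] lies on a cycle fixing [j], two of the three colors at [v] are k / 4,
    so the sum of the doubled colors, halved, is k / 2 plus the third color;
    adding k / 2 leaves the third color mod 2, and no longer mentions the
    cycle. *)
Definition vertex_weight j v : nat :=
  (\sum_(h | node h == v) coloring j h.1)./2 + k./2.

Definition cycle_weight l j : nat := \sum_v lies_on l v * vertex_weight j v.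

(** Where the two cycles take different pairs of half-edges, all three doubled
    colors are k / 2. As their sum is even, k / 4 is an integer, and the weight
    5 (k / 4) of [v] is k / 4 mod 2; it is counted once on the left and twice on
    the right, which the crossing term compensates. *)
Lemma odd_vertex_weightD l m j v : act l j = j -> act m j = j ->
  odd (lies_on (l + m)%R v * vertex_weight j v)
    = odd (lies_on l v * vertex_weight j v + lies_on m v * vertex_weight j v
           + k./2./2 * crossing l m v).
Proof.
move=> lj mj; case: (vertexP v) => [no|h1 h2 h3 u e12 e23 memE sumE onE].
  by rewrite crossing0 ?no // !(negbTE (no _)) muln0.
rewrite /vertex_weight /crossing !sumE !onE !mem_edgesD.
have := even_at_trivalent j u e12 e23.
move: (color_fixed (e := h1.1) lj) (color_fixed (e := h2.1) lj).
move: (color_fixed (e := h3.1) lj).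
move: (color_fixed (e := h1.1) mj) (color_fixed (e := h2.1) mj).
move: (color_fixed (e := h3.1) mj).
rewrite -!(edges_of_trivalent _ u e12 e23).
move: (h1.1 \in edges_of l) (h2.1 \in edges_of l).
move: (h1.1 \in edges_of m) (h2.1 \in edges_of m).
move: (coloring _ _ : nat) (coloring _ _ : nat) (coloring _ _ : nat).
move=> a b c.
by case=> -[] [] [] /=; lia.
Qed.

(** A doubled color k / 2 is its own mirror image, so only a flip of the third
    edge at [v] matters, and then [m] goes on along one of the edges of [l]: the
    third color c, an integer, becomes k / 2 - c. *)
Lemma odd_vertex_weight_act l m j v : act l j = j ->
  odd (lies_on l v * vertex_weight (act m j) v)
    = odd (lies_on l v * vertex_weight j v + k./2 * crossing l m v).
Proof.
move=> lj; case: (vertexP v) => [no|h1 h2 h3 u e12 e23 memE sumE onE].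
  by rewrite crossing0 ?no // !(negbTE (no _)) muln0.
rewrite /vertex_weight /crossing !sumE !onE !act_color.
have := even_at_trivalent j u e12 e23.
move: (color_fixed (e := h1.1) lj) (color_fixed (e := h2.1) lj).
move: (color_fixed (e := h3.1) lj).
rewrite -!(edges_of_trivalent _ u e12 e23).
move: (h1.1 \in edges_of l) (h2.1 \in edges_of l).
move: (h1.1 \in edges_of m) (h2.1 \in edges_of m).
move: (ltn_ord (coloring j h1.1)) (ltn_ord (coloring j h2.1)).
move: (ltn_ord (coloring j h3.1)).
move: (coloring _ _ : nat) (coloring _ _ : nat) (coloring _ _ : nat).
move=> a b c.
by move=> ? ? ? [] [] [] [] /=; lia.
Qed.

(** The weight k / 4 in the local defects does not depend on the vertex, and the
    total number of crossings is even. *)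
Lemma odd_cycle_weightD l m j : act l j = j -> act m j = j ->
  odd (cycle_weight (l + m)%R j)
    = odd (cycle_weight l j) (+) odd (cycle_weight m j).
Proof.
move=> lj mj.
transitivity (odd (cycle_weight l j + cycle_weight m j
                   + k./2./2 * \sum_v crossing l m v)).
  rewrite /cycle_weight big_distrr -!big_split !odd_sum /=.
  by apply: eq_bigr => v _; apply: odd_vertex_weightD.
by rewrite !oddD oddM (negbTE (even_crossings _ _)) andbF addbF.
Qed.

Lemma odd_cycle_weight_act l m j : act l j = j ->
  odd (cycle_weight l (act m j)) = odd (cycle_weight l j).
Proof.
move=> lj; transitivity (odd (cycle_weight l j + k./2 * \sum_v crossing l m v)).
  rewrite /cycle_weight big_distrr -!big_split !odd_sum /=.
  by apply: eq_bigr => v _; apply: odd_vertex_weight_act.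
by rewrite oddD oddM (negbTE (even_crossings _ _)) andbF addbF.
Qed.

Lemma odd_third_edge_sum l j v : act l j = j ->
  odd (\sum_(h | node h == v)
         (lies_on l v && (h.1 \notin edges_of l)) * (coloring j h.1)./2)
  = odd (lies_on l v * vertex_weight j v).
Proof.
move=> lj; case: (vertexP v) => [no|h1 h2 h3 u e12 e23 memE sumE onE].
  by rewrite (negbTE (no _)) big1.
rewrite /vertex_weight !sumE !onE.
have := even_at_trivalent j u e12 e23.
move: (color_fixed (e := h1.1) lj) (color_fixed (e := h2.1) lj).
move: (color_fixed (e := h3.1) lj).
rewrite -!(edges_of_trivalent _ u e12 e23).
move: (h1.1 \in edges_of l) (h2.1 \in edges_of l).
move: (coloring _ _ : nat) (coloring _ _ : nat) (coloring _ _ : nat).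
move=> a b c.
by case=> -[] /=; lia.
Qed.

(** This is the integrality of the color of an external edge: two edges with
    doubled color k / 2 meet it, and the three doubled colors have an even
    sum. *)
Lemma even_next_to l j (h : halfedge G) : act l j = j ->
  h.1 \notin edges_of l -> lies_on l (node h) -> ~~ odd (coloring j h.1).
Proof.
move=> lj hl; case: (vertexP (node h)) => [no|h1 h2 h3 u e12 e23 memE sumE onE].
  by rewrite (negbTE (no _)).
have h_at : h \in [:: h1; h2; h3] by rewrite -memE.
have := even_at_trivalent j u e12 e23; rewrite onE.
move: (color_fixed (e := h1.1) lj) (color_fixed (e := h2.1) lj).
move: (color_fixed (e := h3.1) lj).
move: (edges_of_trivalent l u e12 e23).
move: h_at; rewrite in_cons in_cons mem_seq1 => /or3P[] /eqP <-.
all: rewrite (negbTE hl).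
all: move: (_ \in edges_of l) (_ \in edges_of l) => x y.
all: move: (coloring _ _ : nat) (coloring _ _ : nat) (coloring _ _ : nat).
all: move=> a b c.
all: by case: x y => [] []; lia.
Qed.

Lemma external_sum_nat l j : act l j = j ->
  (\sum_(e in external l) Defs.half (coloring j e)
   = (\sum_(e in external l) (coloring j e)./2)%N%:R)%R.
Proof.
move=> lj; rewrite natr_sum; apply: eq_bigr => e; rewrite inE => /andP[el ext].
have ev : ~~ odd (coloring j e).
  case on0: (lies_on l (node (e, false))) ext => ext.
    exact: (even_next_to (h := (e, false)) lj).
  by apply: (even_next_to (h := (e, true)) lj).
rewrite /Defs.half -{1}[nat_of_ord _]odd_double_half (negbTE ev) add0n.
by rewrite -muln2 natrM mulfK.
Qed.

(** Summing over half-edges instead of external edges counts an edge with both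
    ends on the cycle twice, which does not change the parity. *)
Lemma odd_external_sum l j : act l j = j ->
  odd (\sum_(e in external l) (coloring j e)./2) = odd (cycle_weight l j).
Proof.
move=> lj; rewrite /cycle_weight [RHS]odd_sum.
rewrite -(eq_bigr _ (fun v _ => odd_third_edge_sum v lj)) -odd_sum.
pose F h :=
  (lies_on l (node h) && (h.1 \notin edges_of l)) * (coloring j h.1)./2.
rewrite (eq_bigr (fun v => \sum_(h | node h == v) F h)) => [|v _]; last first.
  by apply: eq_bigr => h /eqP <-.
rewrite sum_halfedges big_mkcond !odd_sum /=.
apply: eq_bigr => e _; rewrite /external in_set /F /=.
by case: (e \in _) (lies_on _ _) (lies_on _ _) => -[] [] /=; lia.
Qed.

End Colorings.

(** * Signs as units *)

Section SignUnits.
Variable R : comPzRingType.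

Lemma unit_mulC (a b : units R) : (a * b = b * a)%g.
Proof. by apply: ring_of_unit_inj; apply: mulrC. Qed.

Lemma unit_oppr1_subproof : ((-1) * (-1) == 1 :> R)%R.
Proof. by rewrite mulrNN mulr1. Qed.

Definition sign_unit (b : bool) : units R :=
  if b then (Sub ((-1)%R, (-1)%R) unit_oppr1_subproof : units R) else 1%g.

Lemma ring_of_sign_unit b : ring_of_unit (sign_unit b) = ((-1) ^+ b)%R.
Proof. by case: b. Qed.

Lemma sign_unit_addb b c : sign_unit (b (+) c) = (sign_unit b * sign_unit c)%g.
Proof.
apply: ring_of_unit_inj; rewrite ring_of_sign_unit signr_addb.
by rewrite -!ring_of_sign_unit.
Qed.

End SignUnits.

Theorem theorem4p3 (k : nat) (k_gt0 : (0 < k)%N) (k_even : ~~ odd k)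
    (R : comPzRingType) (g n : nat) (G : unitrivalent_graph g n)
    (j' : {ffun 'I_n -> 'I_k.+1}) :
  (exists d : cochain1 R G j', external_edge_cocycle d)
  /\ (forall d d' : cochain1 R G j',
        external_edge_cocycle d -> external_edge_cocycle d' ->
        cohomologous d d').
Proof.
have a0 := @act0 k g n G j'; have aD := @actD k g n G j'.
split=> [|d d' [dD dE] [d'D d'E]].
  pose chi l (j : QCG G j') := sign_unit R (odd (cycle_weight l j)).
  have [l m j lj mj|l m j lj|d [dD dE]] :=
    cocycle_of_characters a0 aD (chi := chi).
  - by rewrite /chi odd_cycle_weightD // addbC sign_unit_addb.
  - by rewrite /chi odd_cycle_weight_act.
  exists (fun l => [ffun j => d l j]); split=> [l m j|l j lj].
    by rewrite !ffunE dD.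
  rewrite ffunE dE // ring_of_sign_unit external_sum_nat // natrK.
  by rewrite -[RHS]signr_odd odd_external_sum.
pose r l j := (d l j * (d' l j)^-1)%g.
have rD : twisted_cocycle (@act k g n G j') r.
  move=> l m j; rewrite /r dD d'D invgM -!mulgA; congr (_ * _)%g.
  by rewrite mulgA [LHS]unit_mulC.
have r1 l (j : QCG G j') : act l j = j -> r l j = 1%g.
  move=> lj; rewrite /r (_ : d l j = d' l j) ?mulgV //.
  by apply: ring_of_unit_inj; rewrite dE // d'E.
have [c cE] := coboundary_of_trivial_on_stabilisers a0 aD rD r1.
by exists [ffun j => c j] => l j; rewrite !ffunE -cE.
Qed.
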